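(* There is an absolute constant $c>0$ such that the following holds. Let $k$ be a positive integer and let $d \geq 4$ be an integer. Then there exists a set $P$ of points in $\mathbb{R}^d$ such that, letting $\mathcal{R}$ denote the set system induced on $P$ by half-spaces of $\mathbb{R}^d$, we have $$\operatorname{vcdim}\left(\mathcal{R}^{k\cup}\right) \geq c \cdot \operatorname{vcdim}(\mathcal{R}) \cdot k \log k \quad\text{and}\quad \operatorname{vcdim}\left(\mathcal{R}^{k\cup}\right) \geq c\cdot d \cdot k \log k,$$ and likewise $$\operatorname{vcdim}\left(\mathcal{R}^{k\cap}\right) \geq c \cdot \operatorname{vcdim}(\mathcal{R}) \cdot k \log k \quad\text{and}\quad \operatorname{vcdim}\left(\mathcal{R}^{k\cap}\right) \geq c\cdot d \cdot k \log k.$$ (In the paper's notation: $\operatorname{vcdim}(\mathcal{R}^{k\cup}) = \Omega(\operatorname{vcdim}(\mathcal{R})\cdot k\log k) = \Omega(d\cdot k\log k)$, and the same for $\mathcal{R}^{k\cap}$.)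
   Context: A set system $(X,\mathcal{R})$ consists of a set $X$ and a family $\mathcal{R}$ of subsets of $X$. The set system induced on $P \subseteq \mathbb{R}^d$ by half-spaces is $\mathcal{R} = \{P \cap H : H \text{ a (closed or open) half-space of } \mathbb{R}^d\}$. For an integer $k \geq 1$, the $k$-fold union is $\mathcal{R}^{k\cup} = \{R_1 \cup \cdots \cup R_k : R_1,\dots,R_k \in \mathcal{R}\}$ (the $R_i$ need not be distinct), and the $k$-fold intersection is $\mathcal{R}^{k\cap} = \{R_1 \cap \cdots \cap R_k : R_1,\dots,R_k \in \mathcal{R}\}$ (the $R_i$ need not be distinct). For $Y \subseteq X$, $\mathcal{R}$ shatters $Y$ if $\{Y \cap R : R \in \mathcal{R}\}$ is the full power set of $Y$; $\operatorname{vcdim}(\mathcal{R})$ is the largest size of a subset of $X$ shattered by $\mathcal{R}$. Logarithms are base 2. *)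

(* Defs.v *)
From HB Require Import structures.
From mathcomp Require Import all_boot all_order all_algebra.
From mathcomp Require Import Rstruct.
From Stdlib Require Import Reals.

Set Implicit Arguments. Unset Strict Implicit. Unset Printing Implicit Defensive.
Import Order.TTheory GRing.Theory Num.Theory.

Definition shatters {T : eqType} (X : T -> Prop) (F : (T -> Prop) -> Prop)
    (Y : seq T) : Prop :=
  uniq Y /\ (forall y, y \in Y -> X y) /\
  forall Z : T -> Prop, (forall z, Z z -> z \in Y) ->
    exists S, F S /\ forall y, (y \in Y /\ S y) <-> Z y.

Definition is_vcdim {T : eqType} (X : T -> Prop) (F : (T -> Prop) -> Prop)
    (n : nat) : Prop :=
  (exists Y, shatters X F Y /\ size Y = n) /\
  (forall Y, shatters X F Y -> (size Y <= n)%N).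

Definition point (d : nat) := 'rV[R]_d.

Local Open Scope ring_scope.
Definition dotp (d : nat) (a x : point d) : R :=
  \sum_(i < d) a ord0 i * x ord0 i.
Local Close Scope ring_scope.

(* H is a closed or open half-space { x | <a,x> <= b } or { x | <a,x> < b }
   with a <> 0 (the other orientations are obtained by negating a, b). *)
Definition halfspace (d : nat) (H : point d -> Prop) : Prop :=
  exists (a : point d) (b : R), a <> (GRing.zero : point d) /\
    ((forall x, H x <-> Rle (dotp a x) b) \/
     (forall x, H x <-> Rlt (dotp a x) b)).

Definition halfspace_system (d : nat) (P : point d -> Prop)
    : (point d -> Prop) -> Prop :=
  fun S => exists H, halfspace H /\ forall x, S x <-> (P x /\ H x).

(* k-fold unions / intersections (members need not be distinct). *)
Definition kunion {T : Type} (k : nat) (F : (T -> Prop) -> Prop)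
    : (T -> Prop) -> Prop :=
  fun S => exists Rs : 'I_k -> (T -> Prop),
    (forall i, F (Rs i)) /\ forall x, S x <-> exists i, Rs i x.

Definition kinter {T : Type} (k : nat) (F : (T -> Prop) -> Prop)
    : (T -> Prop) -> Prop :=
  fun S => exists Rs : 'I_k -> (T -> Prop),
    (forall i, F (Rs i)) /\ forall x, S x <-> forall i, Rs i x.

Definition log2 (x : R) : R := Rdiv (Rpower.ln x) (Rpower.ln (INR 2)).

(* Main.v *)
(** A family of n 2^(n-1) axis-parallel rectangles is built recursively such that
    each of its subfamilies is exactly the set of rectangles hit by some 2^n points
    (these point sets are the binary digital nets; each rectangle is an independent
    switch).  A rectangle lifts to a point of R^4 and a point of the plane to a
    half-space { a.x <= 4 } so that incidence is preserved.  As the right-hand side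
    is always 4, floor(d/4) copies placed in orthogonal coordinate blocks of R^d are
    controlled simultaneously by the same 2^n <= k half-spaces.  Radon's argument
    bounds the VC-dimension of half-spaces by d+1, and complementation turns unions
    into intersections. *)

Require Import Defs.
From Stdlib Require Import Reals.
From HB Require Import structures.
From mathcomp Require Import all_boot all_order all_algebra.
From mathcomp Require Import Rstruct boolp.
From mathcomp Require Import zify lra.

Set Implicit Arguments. Unset Strict Implicit. Unset Printing Implicit Defensive.
Import Order.TTheory GRing.Theory Num.Theory.

(** * Rectangles in the integer grid with independent switches *)

Record rect := Rect { rxlo : nat; rxhi : nat; rylo : nat; ryhi : nat }.

Definition in_rect (r : rect) (x y : nat) : bool :=
  (rxlo r <= x < rxhi r) && (rylo r <= y < ryhi r).

(* The halves [0, N) and [N, 2N) in x carry independent copies, stretched by 2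
   in y; the new rectangle of row y occupies the left half of row 2y+1.  Rows 2y
   and 2y+1 receive the left and right points of the old row y, in either order,
   and this order decides whether the new rectangle is hit. *)
Lemma exact_hitting_rects (n : nat) :
  exists (J : finType) (r : J -> rect),
    [/\ #|J| * 2 = n * 2 ^ n, forall j, rxhi (r j) <= 2 ^ n &
     forall s : pred J, exists q : nat -> nat,
       (forall y, y < 2 ^ n -> q y < 2 ^ n) /\
       forall j, s j <-> exists2 y, y < 2 ^ n & in_rect (r j) (q y) y].
Proof.
elim: n => [|n [J [r [cJ rJ hJ]]]].
  exists void, (fun _ => Rect 0 0 0 0); split=> [|[]|s]; first by rewrite card_void.
  by exists (fun=> 0); split=> // -[].
set N := 2 ^ n in cJ rJ hJ *.
have EN : 2 ^ n.+1 = N.*2 by rewrite expnS mul2n.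
pose r' (j : J + J + 'I_N) := match j with
  | inl (inl j) => Rect (rxlo (r j)) (rxhi (r j)) (rylo (r j)).*2 (ryhi (r j)).*2
  | inl (inr j) =>
      Rect (N + rxlo (r j)) (N + rxhi (r j)) (rylo (r j)).*2 (ryhi (r j)).*2
  | inr y => Rect 0 N y.*2.+1 y.*2.+2
  end.
exists (J + J + 'I_N)%type, r'; rewrite EN; split.
- by rewrite !card_sum card_ord; nia.
- by case=> [[j|j]|y] /=; have := rJ; [move/(_ j)| move/(_ j) |]; lia.
move=> s.
have [qL [qLN hL]] := hJ (fun j => s (inl (inl j))).
have [qR [qRN hR]] := hJ (fun j => s (inl (inr j))).
(* [u y] is the prescribed state of the new rectangle of row [y]; the default [false] concerns only
   rows beyond [N]. With [q] below, the left point of old row [y] moves to row [u y + y.*2] and the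
   right one to row [~~ u y + y.*2], so row [y.*2.+1] has its point on the left exactly when [u y]
   holds. *)
pose u y := if insub y is Some i then s (inr (i : 'I_N)) else false.
pose q y := if odd y == u y./2 then qL y./2 else N + qR y./2.
exists q; split.
  move=> y yN; have y2 : y./2 < N by lia.
  by rewrite /q; case: ifP => _; have := qLN _ y2; have := qRN _ y2; lia.
have half (b : bool) y : (b + y.*2)./2 = y by rewrite half_bit_double.
case=> [[j|j]|y].
- apply: (iff_trans (hL j)); split=> -[y yN]; rewrite /in_rect /=.
    move=> /andP[hx hy]; exists (u y + y.*2); first by case: (u y); lia.
    rewrite /q half oddD odd_double addbF oddb eqxx hx /=.
    by case: (u y); lia.
  have y2 : y./2 < N by lia.
  (* A right point has abscissa at least [N], and the bound on [rxhi], carried through the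
     induction, keeps it out of the left copy. *)
  rewrite /q; case: ifP => _ /andP[hx hy]; last by have := rJ j; lia.
  by exists y./2 => //; rewrite hx /=; lia.
- apply: (iff_trans (hR j)); split=> -[y yN]; rewrite /in_rect /=.
    move=> /andP[hx hy]; exists (~~ u y + y.*2); first by case: (u y); lia.
    rewrite /q half oddD odd_double addbF oddb.
    have -> : (~~ u y == u y) = false by case: (u y).
    by rewrite !leq_add2l ltn_add2l hx /=; case: (u y); lia.
  have y2 : y./2 < N by lia.
  rewrite /q; case: ifP => _ /andP[hx hy]; first by have := qLN _ y2; lia.
  by exists y./2 => //; apply/andP; split; lia.
- have uy : u y = s (inr y) by rewrite /u valK.
  have yN := ltn_ord y.
  split=> [sy|[z zN]].
    exists (true + y.*2); first by lia.
    rewrite /in_rect /q half oddD odd_double uy sy /=.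
    by have := qLN _ yN; lia.
  rewrite /in_rect /= => /andP[hx hz].
  have Ez : z = true + y.*2 by lia.
  move: hx; rewrite /q Ez half oddD odd_double uy /=.
  by case: (s (inr y)) => //=; lia.
Qed.

(** * Lifting rectangle incidences to half-spaces of four-dimensional space *)

Local Open Scope ring_scope.

(* The point [lift_rect r] satisfies [\sum_i lift_point x y i * lift_rect r i <= 4]
   iff (x, y) is in [r]: each summand is at most 1 when the corresponding side
   constraint holds, and at least 5 when it fails. *)
Definition lift_rect (r : rect) (i : nat) : R :=
  match i with
  | 0 => 5 ^+ rxlo r
  | 1 => (5 ^+ rxhi r)^-1
  | 2 => 5 ^+ rylo r
  | _ => (5 ^+ ryhi r)^-1
  end.

Definition lift_point (x y : nat) (i : nat) : R :=
  match i with
  | 0 => (5 ^+ x)^-1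
  | 1 => 5 ^+ x.+1
  | 2 => (5 ^+ y)^-1
  | _ => 5 ^+ y.+1
  end.

Lemma exp5_div_le1 (a b : nat) : (a <= b)%N -> 5 ^+ a / 5 ^+ b <= 1 :> R.
Proof.
by move=> ab; rewrite ler_pdivrMr ?exprn_gt0 // mul1r ler_weXn2l // ler1n.
Qed.

Lemma exp5_div_ge5 (a b : nat) : (b < a)%N -> 5 <= 5 ^+ a / 5 ^+ b :> R.
Proof.
by move=> ab; rewrite ler_pdivlMr ?exprn_gt0 // -exprS ler_weXn2l // ler1n.
Qed.

Lemma lift_incidence (r : rect) (x y : nat) :
  (\sum_(i < 4) lift_point x y i * lift_rect r i <= 4) = in_rect r x y.
Proof.
rewrite !big_ord_recl big_ord0 /= addr0 /in_rect.
rewrite (mulrC (_ ^-1) (5 ^+ rxlo r)) (mulrC (_ ^-1) (5 ^+ rylo r)).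
(* Positivity prevents the other summands from compensating one that is at least 5. *)
have p0 a b : 0 < 5 ^+ a / 5 ^+ b :> R by rewrite divr_gt0 ?exprn_gt0.
move: (p0 (rxlo r) x) (p0 x.+1 (rxhi r)) (p0 (rylo r) y) (p0 y.+1 (ryhi r)).
case: (leqP (rxlo r) x) => [/exp5_div_le1|/exp5_div_ge5] h1;
case: (ltnP x (rxhi r)) => [/exp5_div_le1|]; try (rewrite -ltnS; move/exp5_div_ge5);
move=> h2;
case: (leqP (rylo r) y) => [/exp5_div_le1|/exp5_div_ge5] h3;
case: (ltnP y (ryhi r)) => [/exp5_div_le1|]; try (rewrite -ltnS; move/exp5_div_ge5);
by move=> h4 p1 p2 p3 p4 /=; lra.
Qed.

Lemma sum_block4 (d b : nat) (g : nat -> R) : (b < d %/ 4)%N ->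
  \sum_(i < d) (if (i %/ 4 == b)%N then g i else 0) = \sum_(i < 4) g (b * 4 + i)%N.
Proof.
move=> bd.
rewrite -(big_mkord xpredT (fun i => if (i %/ 4 == b)%N then g i else 0)).
rewrite (@big_cat_nat _ _ _ (b * 4)%N) //=; last by lia.
rewrite (@big_cat_nat _ _ _ (b * 4 + 4)%N (b * 4)%N) //=; [|lia|lia].
rewrite big_nat big1 ?add0r; last by move=> i hi; case: eqP => //; lia.
rewrite [X in _ + X]big_nat [X in _ + X]big1 ?addr0; last first.
  by move=> i hi; case: eqP => //; lia.
rewrite -{1}[(b * 4)%N]add0n big_addn addKn big_mkord.
by apply: eq_bigr => i _; have := ltn_ord i => i4; case: eqP; rewrite addnC //; lia.
Qed.

(** * Half-spaces: complements and Radon's bound *)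

Lemma halfspaceC (d : nat) (H : point d -> Prop) :
  halfspace H -> halfspace (fun x => ~ H x).
Proof.
have dN (a x : point d) : dotp (- a) x = - dotp a x.
  by rewrite /dotp -sumrN; apply: eq_bigr => i _; rewrite mxE mulNr.
case=> a [b [a0 hH]]; exists (- a), (- b); split.
  by move=> /eqP; rewrite oppr_eq0 => /eqP.
case: hH => hH; [right|left] => x; rewrite hH dN.
  split=> [/RleP|/RltP]; first by rewrite -ltNge => h; apply/RltP; rewrite ltrN2.
  by rewrite ltrN2 => h /RleP; rewrite leNgt h.
split=> [/RltP|/RleP]; first by rewrite -leNgt => h; apply/RleP; rewrite lerN2.
by rewrite lerN2 => h /RltP; rewrite ltNge h.
Qed.

(** With a coordinate 1 appended, the points are more than [d.+1] vectors in dimension [d.+1], hence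
    linearly dependent; the added coordinate absorbs the constant [b]. *)
Lemma affine_dependence (d : nat) (Y : seq (point d)) : (d.+1 < size Y)%N ->
  exists2 u : 'rV[R]_(size Y), u != 0 &
    forall (a : point d) (b : R), \sum_i u ord0 i * (dotp a Y`_i - b) = 0.
Proof.
move=> sY.
pose M : 'M[R]_(size Y, d + 1) := row_mx (\matrix_(i, j) Y`_i ord0 j) (const_mx 1).
have : kermx M != 0.
  by rewrite kermx_eq0 /row_free; have := rank_leq_col M; lia.
case/rowV0Pn=> u /sub_kermxP uM u0; exists u => // a b.
have : u *m M *m col_mx a^T (const_mx (- b)) = 0 by rewrite uM mul0mx.
rewrite -mulmxA mul_row_col => /matrixP /(_ ord0 ord0); rewrite [in RHS]mxE => e0.
rewrite -[RHS]e0 mxE; apply: eq_bigr => i _; congr (_ * _).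
rewrite !mxE big_ord_recl big_ord0 !mxE mul1r addr0; congr (_ + _).
by apply: eq_bigr => j _; rewrite !mxE mulrC.
Qed.

(** A half-space cutting out exactly the points of positive weight in an affine dependence makes
    every term of the dependence nonpositive. The terms sum to 0, so each vanishes. This forces all
    weights to have one sign, and since they sum to 0 they are all zero. *)
Lemma vcdim_halfspace_le (d : nat) (P : point d -> Prop) (Y : seq (point d)) :
  shatters P (halfspace_system P) Y -> (size Y <= d.+1)%N.
Proof.
case=> uY [YP shY]; rewrite leqNgt; apply/negP => /affine_dependence[u u0 hu].
pose Z y := exists2 i : 'I_(size Y), y = Y`_i & 0 < u ord0 i.
have YY (i : 'I_(size Y)) : Y`_i \in Y by rewrite mem_nth.
have [|S [[H [[a [b [_ hH]]] hS]] SZ]] := shY Z.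
  by move=> z [i -> _]; rewrite mem_nth.
have HZ (i : 'I_(size Y)) : H Y`_i <-> 0 < u ord0 i.
  split=> [Hi|ui].
    have /SZ[j /eqP] : Y`_i \in Y /\ S Y`_i by split=> //; apply/hS; split; auto.
    by rewrite nth_uniq // => /eqP ij; rewrite (ord_inj ij).
  by have /SZ[_ /hS[]] : Z Y`_i by exists i.
have sum0 : \sum_i u ord0 i = 0.
  (* The zero vector with constant -1 reduces the dependence to the sum of the weights. *)
  rewrite -[RHS](hu 0 (-1)) /dotp; apply: eq_bigr => i _.
  by rewrite big1 ?opprK ?add0r ?mulr1 // => j _; rewrite mxE mul0r.
have allz (e : R) : e != 0 -> (forall i, 0 <= e * u ord0 i) -> False.
  move=> e0 pos; case/negP: u0; apply/eqP/rowP => i; rewrite mxE.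
  have /psumr_eq0P h : \sum_i e * u ord0 i = 0 by rewrite -mulr_sumr sum0 mulr0.
  by have /eqP := h (fun j _ => pos j) i isT; rewrite mulf_eq0 (negbTE e0) => /eqP.
pose v i := u ord0 i * (dotp a Y`_i - b).
have v0 : (forall i, v i <= 0) -> forall i, v i = 0.
  move=> vle i; have /psumr_eq0P h : \sum_i - v i = 0 by rewrite sumrN hu oppr0.
  apply: oppr_inj; rewrite oppr0; apply: h => // j _.
  by rewrite oppr_ge0.
case: hH => hH.
- have hH' (i : 'I_(size Y)) : (dotp a Y`_i <= b) = (0 < u ord0 i).
    by apply/idP/idP => [/RleP /hH /HZ|/HZ /hH /RleP].
  have vle i : v i <= 0.
    rewrite /v; case: (ltP 0 (u ord0 i)) (hH' i) => hi; last move/negbT; rewrite -?ltNge => h; nra.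
  (* Outside a closed half-space the inequality is strict, so no weight is negative. *)
  apply: (allz 1) => [|i]; first by rewrite oner_eq0.
  have := v0 vle i; rewrite /v mul1r leNgt => vi; apply/negP => hi.
  have := hH' i; rewrite (ltNge 0) (ltW hi) /= => /negbT; rewrite -ltNge; nra.
- have hH' (i : 'I_(size Y)) : (dotp a Y`_i < b) = (0 < u ord0 i).
    by apply/idP/idP => [/RltP /hH /HZ|/HZ /hH /RltP].
  have vle i : v i <= 0.
    rewrite /v; case: (ltP 0 (u ord0 i)) (hH' i) => hi; last move/negbT; rewrite -?leNgt => h; nra.
  (* Here it is strict inside, so no weight is positive. *)
  apply: (allz (-1)) => [|i]; first by rewrite oppr_eq0 oner_eq0.
  have := v0 vle i; rewrite /v mulN1r oppr_ge0 leNgt => vi; apply/negP => hi.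
  have := hH' i; rewrite hi => h; nra.
Qed.

(* Shattering in general, and passing from unions to intersections *)
Local Close Scope ring_scope.

Lemma is_vcdim_exists (T : eqType) (Y : seq T) (F : (T -> Prop) -> Prop) :
  (exists S, F S) -> exists n, is_vcdim (fun x => x \in Y) F n.
Proof.
move=> [S FS]; pose X x := x \in Y.
pose p n := `[< exists Y', shatters X F Y' /\ size Y' = n >].
have ex : exists n, p n.
  exists 0; apply/asboolP; exists [::]; split => //; split=> //; split=> // Z hZ.
  by exists S; split=> // y; split=> [[]//|/hZ].
have ub n : p n -> n <= size Y.
  by move=> /asboolP[Y' [[uY' [YY' _]] <-]]; apply: uniq_leq_size.
case: (ex_maxnP ex ub) => n /asboolP pn maxn; exists n; split=> // Y' shY'.
by apply: maxn; apply/asboolP; exists Y'.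
Qed.

Lemma shatters_codom (J : finType) (T : eqType) (f : J -> T)
    (F : (T -> Prop) -> Prop) :
  (forall s : pred J, exists S, F S /\ forall j, S (f j) <-> s j) ->
  shatters (fun x => x \in codom f) F (codom f).
Proof.
move=> h; split; last split => //.
  (* A set selecting [i] alone separates [f i] from every other value, so [f] is injective. *)
  apply/injectiveP => i j fij; have [S [_ hS]] := h (pred1 i).
  have : S (f i) by apply/hS; apply: eqxx.
  by rewrite fij => /hS /eqP.
move=> Z hZ; have [S [FS hS]] := h (fun j => `[< Z (f j) >]).
exists S; split=> // y; split=> [[/codomP[j ->]]|Zy]; first by move=> /hS /asboolP.
by have /codomP[j yj] := hZ _ Zy; split; [exact: hZ|rewrite yj; apply/hS/asboolP; rewrite -yj].
Qed.

(** De Morgan: a union that traces the complement of [Z] in [Y] becomes, after complementing each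
    half-space within [P], an intersection that traces [Z]. *)
Lemma kinter_shatters (d k : nat) (P : point d -> Prop) (Y : seq (point d)) :
  0 < k -> shatters P (kunion k (halfspace_system P)) Y ->
  shatters P (kinter k (halfspace_system P)) Y.
Proof.
move=> k0 [uY [YP sh]]; split=> //; split=> // Z hZ.
have [|S [[Rs [hRs hS]] SZ]] := sh (fun y => y \in Y /\ ~ Z y); first by move=> z [].
exists (fun x => forall i, P x /\ ~ Rs i x); split.
  exists (fun i x => P x /\ ~ Rs i x); split=> // i.
  have [H [hH HR]] := hRs i; exists (fun x => ~ H x); split; first exact: halfspaceC.
  by move=> x; rewrite HR; split=> -[Px h]; split=> //; [move=> ?; apply: h|case].
move=> y; split=> [[yY hy]|Zy].
  apply: contrapT => nZ.
  have /SZ[_ /hS[i Ri]] : y \in Y /\ ~ Z y by [].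
  by case: (hy i).
have yY := hZ _ Zy; split=> // i; split; first exact: YP.
by move=> Ri; have /SZ[] : y \in Y /\ S y by split=> //; apply/hS; exists i.
Qed.

(** * The shattered set: orthogonal copies of the lifted rectangles *)

Local Open Scope ring_scope.

(** There is one half-space per row. In block [b] its normal vector lifts the point of that row in
    the hitting set chosen for copy [b]; a point of that copy vanishes off its block, so it tests
    only this incidence. *)
Lemma halfspaces_shatter (n k d : nat) : (2 ^ n <= k)%N -> (4 <= d)%N ->
  exists (Y : seq (point d)),
    (size Y * 2 = d %/ 4 * (n * 2 ^ n))%N /\
    shatters (fun x => x \in Y) (kunion k (halfspace_system (fun x => x \in Y))) Y.
Proof.
move=> nk d4; have [J [r [cJ _ hJ]]] := exact_hitting_rects n.
pose f (jb : J * 'I_(d %/ 4)) : point d :=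
  \row_i (if (i %/ 4 == jb.2)%N then lift_rect (r jb.1) (i %% 4) else 0).
exists (codom f); split.
  by rewrite size_codom card_prod card_ord mulnAC cJ mulnC.
apply: shatters_codom => s.
have /choice[q hq] (b : 'I_(d %/ 4)) := hJ (fun j => s (j, b)).
have t0 : (0 < d %/ 4)%N by lia.
(* Coordinates left over when 4 does not divide [d] default to block 0; this is harmless, as all
   points of the set are zero there. *)
pose blk (i : nat) : 'I_(d %/ 4) := insubd (Ordinal t0) (i %/ 4)%N.
(* Rows beyond [2 ^ n] repeat row 0. *)
pose row (h : 'I_k) : nat := if (h < 2 ^ n)%N then val h else 0%N.
pose a (h : 'I_k) : point d :=
  \row_i lift_point (q (blk i) (row h)) (row h) (i %% 4).
have af h j b : dotp (a h) (f (j, b)) =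
    \sum_(i < 4) lift_point (q b (row h)) (row h) i * lift_rect (r j) i.
  pose g i := lift_point (q b (row h)) (row h) (i %% 4) * lift_rect (r j) (i %% 4).
  rewrite /dotp; transitivity (\sum_(i < d) if (i %/ 4 == b)%N then g i else 0).
    apply: eq_bigr => i _; rewrite !mxE /=; case: eqP => [ib|_]; last by rewrite mulr0.
    by rewrite /g /blk ib /insubd valK.
  rewrite sum_block4 ?ltn_ord //; apply: eq_bigr => i _.
  by rewrite /g modnMDl modn_small.
have a0 h : a h <> 0.
  move=> /rowP /(_ (Ordinal (leq_trans (ltn0Sn 3) d4))) /eqP; rewrite !mxE /=.
  by rewrite invr_eq0 expf_eq0 pnatr_eq0 andbF.
pose Rs (h : 'I_k) x := x \in codom f /\ Rle (dotp (a h) x) 4%:R.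
exists (fun x => exists h, Rs h x); split.
  exists Rs; split=> // h; exists (fun x => Rle (dotp (a h) x) 4%:R); split=> //.
  by exists (a h), 4%:R; split; [exact: a0|left=> x; apply: iff_refl].
move=> [j b]; have [qN hb] := hq b.
have rowlt h : (row h < 2 ^ n)%N by rewrite /row; case: ifP => //; rewrite expn_gt0.
split=> [[h [_ /RleP]]|/(hb j)[y yN yr]].
  by rewrite af lift_incidence => hr; apply/(hb j); exists (row h).
exists (Ordinal (leq_trans yN nk)); split; first exact: codom_f.
by apply/RleP; rewrite af lift_incidence /row /= yN.
Qed.

Local Close Scope ring_scope.

(** * Logarithmic estimates and constants *)

Lemma ln_nondecreasing (x y : R) :
  Rlt 0 x -> Rle x y -> Rle (Rpower.ln x) (Rpower.ln y).
Proof.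
move=> x0 [xy|<-]; last exact: Rle_refl.
exact/Rlt_le/Rpower.ln_increasing.
Qed.

Lemma ln2_gt0 : Rlt 0 (Rpower.ln (INR 2)).
Proof.
rewrite -Rpower.ln_1; apply: Rpower.ln_increasing; first exact: Rlt_0_1.
by apply/RltP; rewrite INRE ltr1n.
Qed.

Lemma log2_le (k m : nat) : 0 < k -> k <= 2 ^ m -> (log2 (INR k) <= m%:R)%R.
Proof.
move=> k0 km; apply/RleP; rewrite /log2 -INRE.
apply: (Rmult_le_reg_r _ _ _ ln2_gt0).
rewrite /Rdiv Rmult_assoc Rinv_l ?Rmult_1_r; last exact: Rgt_not_eq ln2_gt0.
rewrite -Rpower.ln_pow; last by apply/RltP; rewrite INRE ltr0n.
apply: ln_nondecreasing; first by apply/RltP; rewrite INRE ltr0n.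
by apply/RleP; rewrite RpowE !INRE -natrX ler_nat.
Qed.

(** The factor 64 combines [d <= 8 * (d %/ 4)], [k <= 2 * 2 ^ n], [log2 k <= 2 * n] and the 2 in the
    formula for [m]. *)
Lemma INR_mul_log2_le (k d m n : nat) : 0 < k -> 4 <= d ->
  m * 2 = d %/ 4 * (n * 2 ^ n) -> 2 ^ n <= k < 2 ^ n.+1 ->
  (d%:R * k%:R * log2 (INR k) <= 64 * m%:R :> R)%R.
Proof.
move=> k0 d4 hm /andP[nk kn].
have lk : (log2 (INR k) <= (n.*2)%:R)%R.
  (* For [n = 0] this holds because [k = 1]; otherwise [n.+1 <= n.*2]. *)
  apply: log2_le => //; case: n hm nk kn => [|n] hm nk kn; first by lia.
  by apply: leq_trans (ltnW kn) _; rewrite leq_pexp2l //; lia.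
apply: (@le_trans _ _ ((d * k)%:R * (n.*2)%:R))%R.
  by rewrite -natrM ler_wpM2l // ler0n.
rewrite -!natrM ler_nat.
have : d <= 8 * (d %/ 4) by lia.
have : k <= 2 * 2 ^ n by rewrite -expnS ltnW.
have -> : 64 * m = (8 * (d %/ 4)) * (2 * 2 ^ n) * n.*2 by rewrite -mul2n; nia.
by move=> h1 h2; rewrite !leq_mul.
Qed.

Theorem theorem1 :
  exists c : R, Rlt 0 c /\
  forall k d : nat, (0 < k)%N -> (4 <= d)%N ->
  exists P : point d -> Prop,
  exists n mU mI : nat,
    is_vcdim P (halfspace_system P) n /\
    is_vcdim P (kunion k (halfspace_system P)) mU /\
    is_vcdim P (kinter k (halfspace_system P)) mI /\
    Rle (Rmult (Rmult (Rmult c (INR n)) (INR k)) (log2 (INR k))) (INR mU) /\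
    Rle (Rmult (Rmult (Rmult c (INR d)) (INR k)) (log2 (INR k))) (INR mU) /\
    Rle (Rmult (Rmult (Rmult c (INR n)) (INR k)) (log2 (INR k))) (INR mI) /\
    Rle (Rmult (Rmult (Rmult c (INR d)) (INR k)) (log2 (INR k))) (INR mI).
Proof.
(* 128 is twice 64: the extra 2 covers the VC-dimension of the half-space system, at most
   [d.+1 <= 2 * d]. *)
exists (128^-1)%R; split; first by apply/RltP; rewrite invr_gt0 ltr0n.
move=> k d k0 d4.
have kn := trunc_log_bounds (isT : 1 < 2) k0; set n := trunc_log 2 k in kn.
have [nk _] := andP kn.
have [Y [sY shU]] := halfspaces_shatter nk d4.
pose P (x : point d) : Prop := x \in Y; rewrite -/P in shU.
have shI := kinter_shatters k0 shU.
(* Tracing the empty set supplies members of the families, needed for their VC-dimensions to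
   exist. *)
have [S1 [[Rs [hRs _]] _]] := shU.2.2 (fun=> False) (fun z => False_ind _).
have [S2 [hS2 _]] := shI.2.2 (fun=> False) (fun z => False_ind _).
have [v hv] : exists v, is_vcdim P (halfspace_system P) v.
  by apply: is_vcdim_exists; exists (Rs (Ordinal k0)).
have [mU hU] : exists v, is_vcdim P (kunion k (halfspace_system P)) v.
  by apply: is_vcdim_exists; exists (fun x => exists i, Rs i x), Rs.
have [mI hI] : exists v, is_vcdim P (kinter k (halfspace_system P)) v.
  by apply: is_vcdim_exists; exists S2.
exists P, v, mU, mI; do 3 split=> //.
have vd : v <= d.+1.
  by case: hv => -[Y' [sh <-]] _; apply: vcdim_halfspace_le sh.
have log0 : (0 <= log2 (INR k))%R.
  apply/RleP; rewrite /log2; apply: (Rle_mult_inv_pos _ _ _ ln2_gt0).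
  rewrite -Rpower.ln_1; apply: ln_nondecreasing; first exact: Rlt_0_1.
  by apply/RleP; rewrite INRE ler1n.
have main := INR_mul_log2_le k0 d4 sY kn; set L := log2 (INR k) in log0 main *.
have key a m : a <= 2 * d -> size Y <= m ->
    Rle (Rmult (Rmult (Rmult (128^-1)%R (INR a)) (INR k)) (L)) (INR m).
  move=> ad Ym; apply/RleP; rewrite !RmultE !INRE -!mulrA.
  rewrite ler_pdivrMl ?ltr0n //.
  have h1 : (a%:R * (k%:R * L) <= (2 * d)%:R * (k%:R * L))%R.
    by rewrite ler_wpM2r ?ler_nat // mulr_ge0.
  have h2 : ((size Y)%:R <= m%:R :> R)%R by rewrite ler_nat.
  by rewrite natrM in h1; lra.
have YU := hU.2 _ shU; have YI := hI.2 _ shI.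
by do !split; apply: key => //; lia.
Qed.
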